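(* Let $k$ be a field of characteristic $0$. The Hopf algebra $(k\mathcal P,\circ,\Delta)$ of planar rooted trees is dual to the Foissy Hopf algebra $\mathcal H_F$; i.e. $\mathcal H_F^*\cong k\mathcal P$ as graded Hopf algebras, where $\mathcal H_F^*$ is the graded dual.
   Context: A planar rooted tree is a rooted tree in which the children of each vertex are linearly ordered (left to right). $\mathcal P$ is the set of planar rooted trees, $\mathcal P_n$ the subset of those with $n$ non-root vertices, and $k\mathcal P=\bigoplus_{n\ge0}k\mathcal P_n$ the graded vector space with basis $\mathcal P$. Hopf algebra $(k\mathcal P,\circ,\Delta)$. A balanced bracket arrangement (BBA) of weight $n$ is a word in the symbols $\langle$ and $\rangle$, each occurring $n$ times, such that reading left to right the count of $\langle$'s never falls behind the count of $\rangle$'s. A BBA $c$ is irreducible if $c=\langle c'\rangle$ for some BBA $c'$; every BBA is uniquely a juxtaposition $c_1\cdots c_k$ of irreducible BBAs, its components. Planar rooted trees with $n$ non-root vertices correspond bijectively to BBAs of weight $n$: the one-vertex tree $\bullet$ corresponds to the empty BBA, and recursively the components $c_i=\langle c_i'\rangle$ correspond in order to the branches of the root, $c_i'$ being the BBA of the $i$th branch. If $T,T'$ are represented by BBAs $c,c'$ and $c=c_1\cdots c_k$ is the decomposition into components, $T\circ T'$ is the sum (with multiplicity) of the planar rooted trees corresponding to all BBAs obtained by shuffling the $k$ symbols $c_1,\dots,c_k$ (each treated as a single letter, order preserved) into the word of individual bracket symbols $c'$ (order preserved). The coproduct is $\Delta(c)=\sum_{i=0}^k c_1\cdots c_i\otimes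 c_{i+1}\cdots c_k$. The unit is $\bullet$. Foissy Hopf algebra $\mathcal H_F$. As an algebra it is the tensor algebra $T(k\mathcal P)$, with basis the ordered forests $T_1T_2\cdots T_n$ of planar rooted trees, graded by the total number of vertices. The coproduct is multiplicative and on a planar rooted tree $T$ is $\Delta(T)=T\otimes1+\sum_c P^c(T)\otimes R^c(T)$, over all admissible cuts $c$ of $T$: a cut is a subset of the edges, it is admissible if every path from the root to a leaf meets it at most once (the empty cut is admissible), and after removing the edges of $c$, $R^c(T)$ is the component containing the root and $P^c(T)$ is the ordered forest of the remaining components, ordered by the natural left-to-right order on the vertices of the planar rooted tree $T$. The graded dual of a locally finite graded Hopf algebra is $\bigoplus_n\mathcal A_n^*$ with product dual to the coproduct and coproduct dual to the product. *)

(* Defs.v *)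
From HB Require Import structures.
From mathcomp Require Import all_boot all_algebra.
From mathcomp Require Import finmap.
From mathcomp Require Import boolp classical_sets functions.
From mathcomp.multinomials Require Import monalg.

Set Implicit Arguments.
Unset Strict Implicit.
Unset Printing Implicit Defensive.

Import GRing.Theory.

Local Open Scope ring_scope.

(** * Graded Hopf algebras and their graded duals *)

(* An element of the tensor product U (x) V is represented by a finite formal
   sum of pure tensors, given as the list of its terms.  Two such sums denote
   the same tensor iff no bilinear map out of U * V separates them, which is
   the universal property of U (x) V. *)
Definition tensor_eq (k : fieldType) (U V : lmodType k) (s t : seq (U * V)) :
    Prop :=
  forall (W : lmodType k) (B : {bilinear U -> V -> W}),
    \sum_(p <- s) B p.1 p.2 = \sum_(p <- t) B p.1 p.2.

(* Only the structure maps are recorded: the Hopf algebra axioms are not part of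
   the data, and the antipode, being determined by the other maps, appears in
   the notion of isomorphism through [is_antipode].  [hdeg n x] says that x belongs to the
   homogeneous component of degree n, and [hcomul x] is a representative of
   the coproduct of x, meaningful up to [tensor_eq]. *)
Record gradedHopf (k : fieldType) := GradedHopf {
  hcarrier :> lmodType k;
  hdeg : nat -> hcarrier -> Prop;
  hmul : hcarrier -> hcarrier -> hcarrier;
  hone : hcarrier;
  hcomul : hcarrier -> seq (hcarrier * hcarrier);
  hcounit : hcarrier -> k
}.

Arguments hdeg {k g}.
Arguments hmul {k g}.
Arguments hone {k g}.
Arguments hcomul {k g}.
Arguments hcounit {k g}.

Definition is_antipode (k : fieldType) (H : gradedHopf k)
    (S : {linear H -> H}) : Prop :=
  forall x : H,
    \sum_(p <- hcomul x) hmul (S p.1) p.2 = hcounit x *: hone /\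
    \sum_(p <- hcomul x) hmul p.1 (S p.2) = hcounit x *: hone.

Record is_graded_hopf_iso (k : fieldType) (A B : gradedHopf k)
    (f : {linear A -> B}) : Prop := IsGradedHopfIso {
  iso_bij : bijective f;
  iso_deg : forall n x, hdeg n x <-> hdeg n (f x);
  iso_mul : forall x y, f (hmul x y) = hmul (f x) (f y);
  iso_one : f hone = hone;
  iso_comul : forall x,
    tensor_eq (hcomul (f x)) [seq (f p.1, f p.2) | p <- hcomul x];
  iso_counit : forall x, hcounit (f x) = hcounit x;
  iso_antipode : forall (S : {linear A -> A}) (S' : {linear B -> B}),
    is_antipode S -> is_antipode S' -> forall x, f (S x) = S' (f x)
}.

Definition graded_hopf_isomorphic (k : fieldType) (A B : gradedHopf k) : Prop :=
  exists f : {linear A -> B}, is_graded_hopf_iso f.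

Section GradedDual.
Variables (k : fieldType) (H : gradedHopf k).

(* The direct sum of the duals of the homogeneous components, realised as the
   linear forms vanishing on all but finitely many of them. *)
Definition gdual_pred : {pred H -> k^o} := fun f =>
  `[< linear f /\
      exists N, forall n (x : H), (N <= n)%N -> hdeg n x -> f x = 0 >].

Lemma gdual_submod_closed : submod_closed gdual_pred.
Proof.
split.
  apply/asboolP; split; last by exists 0%N.
  by move=> a x y; rewrite /= scaler0 addr0.
move=> a f g /asboolP[lf [M fM]] /asboolP[lg [N gN]]; apply/asboolP; split.
  move=> b x y.
  rewrite !fctE lf lg !scalerDr !scalerA (mulrC a b) !addrA; congr (_ + _).
  by rewrite -!addrA; congr (_ + _); rewrite addrC.
exists (maxn M N) => n x; rewrite geq_max => /andP[Mn Nn] xn.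
by rewrite !fctE (fM n) // (gN n) // scaler0 addr0.
Qed.

HB.instance Definition _ :=
  GRing.isSubmodClosed.Build k (H -> k^o) gdual_pred gdual_submod_closed.

Definition gdual := {f : H -> k^o | f \in gdual_pred}.

HB.instance Definition _ := Choice.on gdual.
HB.instance Definition _ := SubType.on gdual.
HB.instance Definition _ := [SubChoice_isSubLmodule of gdual by <:].

(* [insubd 0] packs a function known to be in [gdual_pred]; when H is a graded
   Hopf algebra this is the case of the two functions below. *)
Definition gdual_of (f : H -> k^o) : gdual := insubd (0 : gdual) f.

Definition gdual_mul (f g : gdual) : gdual :=
  gdual_of (fun x : H => \sum_(p <- hcomul x) \val f p.1 * \val g p.2).

Definition gdual_one : gdual := gdual_of hcounit.

(* The coproduct of f is the tensor whose pairing with x (x) y is f (x y); it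
   is unique, and it exists when H is locally finite. *)
Definition gdual_comul (f : gdual) : seq (gdual * gdual) :=
  xget [::] [set s : seq (gdual * gdual) | forall x y : H,
    \sum_(p <- s) \val p.1 x * \val p.2 y = \val f (hmul x y)]%classic.

Definition graded_dual : gradedHopf k := {|
  hcarrier := gdual;
  hdeg := fun n (f : gdual) =>
    forall m (x : H), m <> n -> hdeg m x -> \val f x = 0;
  hmul := gdual_mul;
  hone := gdual_one;
  hcomul := gdual_comul;
  hcounit := fun f : gdual => \val f hone
|}.

End GradedDual.

(** * Planar rooted trees and balanced bracket arrangements *)

(* [PNode ts] is the tree whose root has the branches ts, from left to right. *)
Inductive ptree := PNode of seq ptree.

Definition branches (t : ptree) : seq ptree := let: PNode ts := t in ts.

Lemma ptree_rect_nested (P : ptree -> Prop) :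
  (forall ts, foldr (fun t Q => P t /\ Q) True ts -> P (PNode ts)) ->
  forall t, P t.
Proof.
move=> IH; fix F 1 => -[ts]; apply: IH.
by elim: ts => [//|t ts IHts]; split; [apply: F | apply: IHts].
Qed.

Fixpoint ptree_encode (t : ptree) : GenTree.tree unit :=
  let: PNode ts := t in GenTree.Node 0 (map ptree_encode ts).

Fixpoint ptree_decode (g : GenTree.tree unit) : ptree :=
  if g is GenTree.Node _ gs then PNode (map ptree_decode gs) else PNode [::].

Lemma ptree_encodeK : cancel ptree_encode ptree_decode.
Proof.
elim/ptree_rect_nested => ts IH /=; congr PNode; rewrite -map_comp.
by elim: ts IH => [//|t ts IHts] /= [-> /IHts ->].
Qed.

HB.instance Definition _ := Countable.copy ptree (can_type ptree_encodeK).

Fixpoint nonroot_vertices (t : ptree) : nat :=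
  let: PNode ts := t in sumn [seq (nonroot_vertices u).+1 | u <- ts].

Definition vertices (t : ptree) : nat := (nonroot_vertices t).+1.

Definition langle := true.
Definition rangle := false.

Definition is_bba (w : seq bool) : bool :=
  all (fun i => count_mem rangle (take i w) <= count_mem langle (take i w))%N
      (iota 0 (size w).+1)
  && (count_mem langle w == count_mem rangle w).

Fixpoint bba_of (t : ptree) : seq bool :=
  let: PNode ts := t in flatten [seq langle :: rcons (bba_of u) rangle | u <- ts].

(* The irreducible components of [bba_of t]. *)
Definition bba_components (t : ptree) : seq (seq bool) :=
  [seq langle :: rcons (bba_of u) rangle | u <- branches t].

(* The inverse of [bba_of]: [cur] lists, in reverse order, the branches read so
   far at the current vertex, and [stack] does so for its proper ancestors.  The
   value on words that are not balanced is irrelevant. *)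
Fixpoint parse_bba (stack : seq (seq ptree)) (cur : seq ptree) (w : seq bool) :
    ptree :=
  match w, stack with
  | [::], _ => PNode (rev cur)
  | true :: w', _ => parse_bba (cur :: stack) [::] w'
  | false :: w', up :: stack' => parse_bba stack' (PNode (rev cur) :: up) w'
  | false :: _, [::] => PNode [::]
  end.

Definition tree_of_bba (w : seq bool) : ptree := parse_bba [::] [::] w.

Lemma parse_bba_of t stack cur w :
  parse_bba stack cur (bba_of t ++ w)
  = parse_bba stack (rev (branches t) ++ cur) w.
Proof.
elim/ptree_rect_nested: t stack cur w => ts IH stack cur w /=.
elim: ts IH stack cur w => [//|t ts IHts] /= [IHt IH] stack cur w.
rewrite -cats1 -!catA IHt /= cats0 revK IHts //.
by case: t {IHt} => us; rewrite rev_cons cat_rcons.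
Qed.

Lemma bba_ofK : cancel bba_of tree_of_bba.
Proof.
move=> t; rewrite /tree_of_bba -[bba_of t]cats0 parse_bba_of /= cats0 revK.
by case: t.
Qed.

(* [bba_from d w]: w completes a word with d pending opening brackets. *)
Fixpoint bba_from (d : nat) (w : seq bool) : bool :=
  match w, d with
  | [::], _ => d == 0%N
  | true :: w', _ => bba_from d.+1 w'
  | false :: w', d'.+1 => bba_from d' w'
  | false :: _, 0%N => false
  end.

Lemma bba_fromE d w :
  bba_from d w =
  all (fun i => count_mem rangle (take i w) <= count_mem langle (take i w) + d)%N
      (iota 0 (size w).+1)
  && (count_mem langle w + d == count_mem rangle w)%N.
Proof.
elim: w d => [|b w IH] d; first by rewrite /= add0n.
have shift (P : pred nat) n :
    all P (iota 0 n.+1) = P 0%N && all (fun i => P i.+1) (iota 0 n).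
  by rewrite /= (iotaDl 1 0) all_map.
have -> : (size (b :: w)).+1 = (size w).+2 by [].
rewrite shift take0 [count_mem rangle [::]]/= leq0n andTb.
case: b; first rewrite [LHS]IH.
  congr (_ && _); first by apply: eq_all => i; rewrite /= add0n add1n addnS addSn.
  by rewrite /= add0n add1n addnS addSn.
case: d => [|d]; first by rewrite /= take0.
rewrite [LHS]IH; congr (_ && _); last by rewrite /= add0n addnS eqSS.
by apply: eq_all => i; rewrite /= add0n addnS.
Qed.

Lemma is_bbaE w : is_bba w = bba_from 0 w.
Proof.
rewrite bba_fromE addn0; congr (_ && _).
by apply: eq_all => i; rewrite addn0.
Qed.

Lemma bba_from_bba_of t d w : bba_from d (bba_of t ++ w) = bba_from d w.
Proof.
elim/ptree_rect_nested: t d w => ts IH d w /=.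
elim: ts IH d w => [//|t ts IHts] /= [IHt IH] d w.
by rewrite -cats1 -!catA IHt /= IHts.
Qed.

Lemma bba_of_is_bba t : is_bba (bba_of t).
Proof. by rewrite is_bbaE -[bba_of t]cats0 bba_from_bba_of. Qed.

Lemma parse_bbaK stack cur w : bba_from (size stack) w ->
  bba_of (parse_bba stack cur w) =
  foldl (fun v up => bba_of (PNode (rev up)) ++ langle :: v)
        (bba_of (PNode (rev cur)) ++ w) stack.
Proof.
elim: w stack cur => [|[] w IH] stack cur /=.
- by rewrite size_eq0 => /eqP-> /=; rewrite cats0.
- by move=> wP; rewrite (IH (cur :: stack)).
case: stack => [//|up stack] /= wP; rewrite IH //=; congr foldl.
by rewrite rev_cons -cats1 map_cat flatten_cat /= cats0 -cats1 -!catA /= -!catA.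
Qed.

Lemma tree_of_bbaK w : is_bba w -> bba_of (tree_of_bba w) = w.
Proof. by rewrite is_bbaE => wP; rewrite /tree_of_bba parse_bbaK. Qed.

Lemma count_langle_bba_of t : count_mem langle (bba_of t) = nonroot_vertices t.
Proof.
elim/ptree_rect_nested: t => ts IH /=.
elim: ts IH => [//|t ts IHts] /= [IHt /IHts E].
by rewrite -cats1 !count_cat /= E IHt !addn0.
Qed.

(** * The Hopf algebra of planar rooted trees *)

(* All shuffles of two words, with multiplicity. *)
Fixpoint shuffles (T : Type) (s : seq T) : seq T -> seq (seq T) :=
  fix shuffles_s (t : seq T) : seq (seq T) :=
    match s, t with
    | [::], _ => [:: t]
    | _, [::] => [:: s]
    | x :: s', y :: t' =>
        [seq x :: w | w <- shuffles s' t] ++ [seq y :: w | w <- shuffles_s t']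
    end.

Section TreeHopf.
Variable k : fieldType.

Definition tree_mul (t t' : ptree) : {malg k[ptree]} :=
  \sum_(w <- shuffles (bba_components t) [seq [:: b] | b <- bba_of t'])
    << tree_of_bba (flatten w) >>.

Definition tree_comul (t : ptree) : seq (ptree * ptree) :=
  [seq (PNode (take i (branches t)), PNode (drop i (branches t)))
     | i <- iota 0 (size (branches t)).+1].

Definition tree_hopf : gradedHopf k := {|
  hcarrier := {malg k[ptree]};
  hdeg := fun n x => forall t, t \in msupp x -> nonroot_vertices t = n;
  hmul := fun x y =>
    \sum_(t <- msupp x) \sum_(t' <- msupp y) (x@_t * y@_t') *: tree_mul t t';
  hone := << PNode [::] >>;
  hcomul := fun x =>
    [seq (<< x@_t *g p.1 >>, << p.2 >>) | t <- msupp x, p <- tree_comul t];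
  hcounit := fun x => x@_(PNode [::])
|}.

End TreeHopf.

(** * The Foissy Hopf algebra *)

(* A tree in which each edge is marked [true] if it belongs to the cut; the
   mark of an edge is stored with the branch below it. *)
Inductive cut := Cut of seq (bool * cut).

Fixpoint cuts (t : ptree) : seq cut :=
  let: PNode ts := t in
  [seq Cut s | s <- foldr (fun opts ss => [seq o :: s | o <- opts, s <- ss])
                          [:: [::]]
                          [seq [seq (b, c) | b <- [:: false; true], c <- cuts u]
                             | u <- ts]].

(* The marks met along the paths from the root to the leaves. *)
Fixpoint leaf_paths (c : cut) : seq (seq bool) :=
  match c with
  | Cut [::] => [:: [::]]
  | Cut s => flatten [seq [seq bc.1 :: p | p <- leaf_paths bc.2] | bc <- s]
  end.

Definition admissible (c : cut) : bool :=
  all (fun p => count_mem true p <= 1)%N (leaf_paths c).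

(* R^c: the component of the root. *)
Fixpoint trunk (c : cut) : ptree :=
  let: Cut s := c in
  PNode (flatten [seq if bc.1 then [::] else [:: trunk bc.2] | bc <- s]).

(* P^c: the other components. *)
Fixpoint pruned (c : cut) : seq ptree :=
  let: Cut s := c in
  flatten [seq if bc.1 then trunk bc.2 :: pruned bc.2 else pruned bc.2
             | bc <- s].

Section FoissyHopf.
Variable k : fieldType.

(* The words on ptree, i.e. the ordered forests; {malg k[forest]} is their
   monoid algebra, which is the tensor algebra of k[ptree]. *)
Local Notation forest := {fmonom ptree}.

Definition foissy_tree_comul (t : ptree) : seq (forest * forest) :=
  (FMonom [:: t], mone)
    :: [seq (FMonom (pruned c), FMonom [:: trunk c]) | c <- cuts t & admissible c].

Definition foissy_comul (F : forest) : seq (forest * forest) :=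
  foldr (fun t ps => [seq (mmul p.1 q.1, mmul p.2 q.2)
                        | p <- foissy_tree_comul t, q <- ps])
        [:: (mone, mone)] F.

Definition foissy_hopf : gradedHopf k := {|
  hcarrier := {malg k[forest]};
  hdeg := fun n x =>
    forall F : forest, F \in msupp x -> sumn [seq vertices t | t <- F] = n;
  hmul := fun x y => x * y;
  hone := 1;
  hcomul := fun x =>
    [seq (<< x@_F *g p.1 >>, << p.2 >>) | F <- msupp x, p <- foissy_comul F];
  hcounit := fun x => x@_mone
|}.

End FoissyHopf.

(* Main.v *)
(** The isomorphism sends the element dual to an ordered forest T_1...T_n to the
    planar rooted tree whose root has the branches T_1, ..., T_n; it turns the
    coproduct dual to concatenation into deconcatenation of branches.  For the
    products one must see that, for forests F, G and H, the multiplicity of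
    F (x) G in Delta(H) is the number of shuffles of the irreducible components
    of the arrangement of F into the letters of that of G which spell the
    arrangement of H.  Reading such a shuffle from left to right, a component
    standing as a single letter is a subtree of H that is cut off, and the
    remaining brackets spell the trunk. *)

From HB Require Import structures.
Require Import Defs.
From mathcomp Require Import all_boot all_algebra.
From mathcomp Require Import finmap.
From mathcomp Require Import boolp classical_sets functions.
From mathcomp.multinomials Require Import monalg.

Set Implicit Arguments.
Unset Strict Implicit.
Unset Printing Implicit Defensive.

Import GRing.Theory.

(** * Shuffles of bracket words and admissible cuts *)

Local Open Scope nat_scope.

Local Notation forest := {fmonom ptree}.

(** * Unique readability of bracket words *)

Definition bracket (t : ptree) : seq bool := langle :: rcons (bba_of t) rangle.

Definition bba_of_forest (ts : seq ptree) : seq bool :=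
  flatten [seq bracket t | t <- ts].

Lemma bba_ofE t : bba_of t = bba_of_forest (branches t).
Proof. by case: t. Qed.

Lemma bba_of_forest_inj : injective bba_of_forest.
Proof.
move=> ts us E.
by have [] : PNode ts = PNode us by apply: (can_inj bba_ofK).
Qed.

Lemma bba_of_forest_cat ts us :
  bba_of_forest (ts ++ us) = bba_of_forest ts ++ bba_of_forest us.
Proof. by rewrite /bba_of_forest map_cat flatten_cat. Qed.

Lemma bracket_cat t w : bracket t ++ w = langle :: bba_of t ++ rangle :: w.
Proof. by rewrite /bracket /= cat_rcons. Qed.

(** The first closing bracket without a partner marks the end of the balanced word, so the tree and
    the remainder can both be read off. *)
Lemma bba_of_closed_prefix t u v w :
  bba_of t ++ rangle :: v = bba_of u ++ rangle :: w -> t = u /\ v = w.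
Proof.
elim/ptree_rect_nested: t u v w => ts IH [us].
rewrite !bba_ofE /=.
elim: ts IH us => [|t ts IHts] IH [|u us] v w //=; first by case.
case: IH => IHt IH [].
rewrite -[flatten _]/(bba_of_forest ts) -[flatten _]/(bba_of_forest us).
rewrite !cat_rcons -!catA !cat_cons => /IHt [-> E].
by have [[->] ->] := IHts IH _ _ _ E.
Qed.

(** Irreducible arrangements form a prefix code; this decides when a component letter can stand at
    the start of a word to be spelled. *)
Lemma prefix_bracket t u w : prefix (bracket t) (bracket u ++ w) = (t == u).
Proof.
apply/prefixP/eqP => [[v]|->]; last by exists w.
by rewrite !bracket_cat => -[/bba_of_closed_prefix []].
Qed.

(** * Counting the shuffles that spell a given word *)

Definition letters (w : seq bool) : seq (seq bool) := [seq [:: b] | b <- w].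

(** A coefficient of the shuffle product. The words [w] and [v] need not be balanced, so that the
    count can be computed by reading [v] from the left. *)
Definition nshuffles (F : seq ptree) (w v : seq bool) : nat :=
  count (fun x => flatten x == v) (shuffles (map bracket F) (letters w)).

Lemma flatten_letters w : flatten (letters w) = w.
Proof. by elim: w => //= b w ->. Qed.

Lemma shuffles_nil (T : Type) (s : seq T) : shuffles s [::] = [:: s].
Proof. by case: s. Qed.

Lemma nil_shuffles (T : Type) (t : seq T) : shuffles [::] t = [:: t].
Proof. by case: t. Qed.

Lemma shuffles_cons (T : Type) (x y : T) s t :
  shuffles (x :: s) (y :: t) =
  [seq x :: w | w <- shuffles s (y :: t)]
  ++ [seq y :: w | w <- shuffles (x :: s) t].
Proof. by []. Qed.

Lemma nshuffles_nil F w : nshuffles F w [::] = (F == [::]) && (w == [::]).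
Proof.
case: F w => [|t F] [|b w] //.
rewrite /nshuffles /= count_cat !count_map.
by rewrite !(@eq_count _ _ pred0) ?count_pred0 // => x.
Qed.

Lemma count_flatten_cons (x : seq bool) (ss : seq (seq (seq bool))) v :
  count (fun y => flatten y == v) [seq x :: s | s <- ss] =
  if prefix x v then count (fun y => flatten y == drop (size x) v) ss else 0.
Proof.
rewrite count_map; case: prefixP => [[u ->]|E].
  by apply: eq_count => s /=; rewrite drop_size_cat // eqseq_cat // eqxx.
rewrite (@eq_count _ _ pred0) ?count_pred0 // => s /=.
by apply/eqP => Ev; case: E; exists (flatten s).
Qed.

(** A shuffle starts either with the first component, which must then be a prefix of the target, or
    with the first bracket of [w]. *)
Lemma nshuffles_cons F w b v :
  nshuffles F w (b :: v) =
    (if F is t :: F' then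
       if prefix (bracket t) (b :: v)
       then nshuffles F' w (drop (size (bracket t)) (b :: v)) else 0
     else 0)
    + (if w is c :: w' then if c == b then nshuffles F w' v else 0 else 0).
Proof.
have chars u : count (fun y => flatten y == u) [:: letters w] = (w == u).
  by rewrite /= flatten_letters addn0.
rewrite /nshuffles; case: F => [|t F].
  rewrite [map _ _]/= nil_shuffles chars add0n; case: w {chars} => [|c w] //.
  rewrite nil_shuffles /= flatten_letters addn0 eqseq_cons.
  by case: (c == b).
case: w {chars} => [|c w].
  rewrite addn0 [letters _]/= !shuffles_nil [map _ _]/=.
  by rewrite -[[:: _ :: _]]/(map (cons (bracket t)) [:: map bracket F])
     count_flatten_cons.
rewrite [map _ _]/= [letters _]/= shuffles_cons count_cat !count_flatten_cons.
by congr (_ + _); rewrite prefix_cons prefix0s andbT drop1.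
Qed.

(* Two-word prefix removal in continuation-passing style; it makes the nested
   sums over cuts compose by [strip2_cat]. *)
Definition strip2 (S T : eqType) (u : seq S) (v : seq T) (s : seq S) (t : seq T)
    (K : seq S -> seq T -> nat) : nat :=
  if prefix u s && prefix v t then K (drop (size u) s) (drop (size v) t) else 0.

Lemma prefix_catE (T : eqType) (u v s : seq T) :
  prefix (u ++ v) s = prefix u s && prefix v (drop (size u) s).
Proof.
elim: u s => [|x u IH] [|y s] //=; rewrite ?drop0 //.
by rewrite IH andbA.
Qed.

Lemma strip2_cat (S T : eqType) (u u' : seq S) (v v' : seq T) s t K :
  strip2 (u ++ u') (v ++ v') s t K =
  strip2 u v s t (fun s' t' => strip2 u' v' s' t' K).
Proof.
rewrite /strip2 !prefix_catE !size_cat.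
rewrite (addnC (size u)) (addnC (size v)) -!drop_drop.
by case: (prefix u s); case: (prefix v t); rewrite ?andbF.
Qed.

Lemma strip2_nil (S T : eqType) (s : seq S) (t : seq T) K :
  strip2 [::] [::] s t K = K s t.
Proof. by rewrite /strip2 !prefix0s !drop0. Qed.

Lemma strip2_sum (S T : eqType) (u : seq S) (v : seq T) s t I (r : seq I) K :
  strip2 u v s t (fun s' t' => \sum_(i <- r) K i s' t') =
  \sum_(i <- r) strip2 u v s t (K i).
Proof. by rewrite /strip2; case: ifP => // _; rewrite big1. Qed.

Lemma eq_strip2 (S T : eqType) (u : seq S) (v : seq T) s t K K' :
  K =2 K' -> strip2 u v s t K = strip2 u v s t K'.
Proof. by move=> E; rewrite /strip2 E. Qed.

(** No component starts with a closing bracket, so this letter can only come from [w]. *)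
Lemma nshuffles_rangle F w v :
  nshuffles F w (rangle :: v) =
  strip2 [::] [:: rangle] F w (fun F' w' => nshuffles F' w' v).
Proof.
rewrite nshuffles_cons /strip2 prefix0s drop0.
case: F => [|t F]; case: w => [|[] w] //=.
  by rewrite drop0 prefix0s.
by rewrite drop0 prefix0s.
Qed.

(** The opening bracket of [t] belongs either to a component letter, which by the prefix code is [t]
    itself ([t] is cut off), or to [w] (the root of [t] stays in the trunk). *)
Lemma nshuffles_bracket F w t v :
  nshuffles F w (bracket t ++ v) =
    strip2 [:: t] [::] F w (fun F' w' => nshuffles F' w' v) +
    strip2 [::] [:: langle] F w
      (fun F' w' => nshuffles F' w' (bba_of t ++ rangle :: v)).
Proof.
rewrite bracket_cat nshuffles_cons -bracket_cat /strip2 !prefix0s !drop0 andbT.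
congr (_ + _).
  case: F => [|u F] //.
  rewrite prefix_bracket eq_sym prefix_cons prefix0s andbT drop1.
  by case: eqP => // ->; rewrite drop_size_cat.
by case: w => [|[] w] //=; rewrite drop0 prefix0s.
Qed.

(** * Admissible cuts and the coproduct of a forest *)

Lemma foissy_comul_nil :
  foissy_comul (FMonom [::]) = [:: (FMonom [::], FMonom [::])].
Proof. by rewrite /foissy_comul /= -[mone]/(fmone _) fmoneE. Qed.

Lemma foissy_comul_cons t (ts : seq ptree) :
  foissy_comul (FMonom (t :: ts)) =
  [seq (mmul p.1 q.1, mmul p.2 q.2)
     | p <- foissy_tree_comul t, q <- foissy_comul (FMonom ts)].
Proof. by []. Qed.

(** The condition that admissibility imposes below an edge that is cut. *)
Definition nocut (c : cut) : bool :=
  all (fun p => count_mem true p == 0) (leaf_paths c).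

Definition admissible_mark (bc : bool * cut) : bool :=
  if bc.1 then nocut bc.2 else admissible bc.2.

Lemma all_leaf_paths (P : pred (seq bool)) s :
  all P (leaf_paths (Cut s)) =
  if s is [::] then P [::]
  else all (fun bc => all (fun p => P (bc.1 :: p)) (leaf_paths bc.2)) s.
Proof.
case: s => [|bc s]; first by rewrite /= andbT.
rewrite [leaf_paths _]/= all_cat all_map; congr (_ && _).
by elim: s => //= bc' s IH; rewrite all_cat all_map IH.
Qed.

Lemma admissibleE s : admissible (Cut s) = all admissible_mark s.
Proof.
rewrite /admissible all_leaf_paths; case: s => // bc s.
apply: eq_all => -[[] c]; rewrite /admissible_mark /nocut /admissible /=.
  by apply: eq_all => p; rewrite add1n ltnS leqn0.
by apply: eq_all => p; rewrite add0n.
Qed.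

(** Every edge lies on some path to a leaf, so a condition on all paths is never vacuous for a
    marked edge. *)
Lemma leaf_paths_neq0 c : leaf_paths c != [::].
Proof.
move: c; fix F 1 => -[[|[b c] s]] //=.
by have := F c; case: (leaf_paths c).
Qed.

Lemma nocutE s : nocut (Cut s) = all (fun bc => ~~ bc.1 && nocut bc.2) s.
Proof.
rewrite /nocut all_leaf_paths; case: s => // bc s.
apply: eq_all => -[[] c] /=.
  case: (leaf_paths c) (leaf_paths_neq0 c) => // p ps _.
by apply: eq_all => p; rewrite add0n.
Qed.

(** The [foldr] inside [cuts], restated by recursion on the branches. *)
Fixpoint marks (ts : seq ptree) : seq (seq (bool * cut)) :=
  if ts is t :: ts' then
    [seq o :: s | o <- [seq (b, c) | b <- [:: false; true], c <- cuts t],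
                  s <- marks ts']
  else [:: [::]].

Lemma cutsE ts : cuts (PNode ts) = [seq Cut s | s <- marks ts].
Proof. by rewrite /=; congr map; elim: ts => //= t ts ->. Qed.

Lemma big_marks_cons t ts (P : pred (bool * cut))
    (Phi : seq (bool * cut) -> nat) :
  \sum_(s <- marks (t :: ts) | all P s) Phi s =
    \sum_(c <- cuts t | P (false, c)) \sum_(s <- marks ts | all P s)
       Phi ((false, c) :: s)
  + \sum_(c <- cuts t | P (true, c)) \sum_(s <- marks ts | all P s)
       Phi ((true, c) :: s).
Proof.
rewrite [marks _]/= cats0 big_mkcond big_allpairs_dep big_cat /=.
have E b : \sum_(o <- [seq (b, c) | c <- cuts t])
     \sum_(s <- marks ts) (if P o && all P s then Phi (o :: s) else 0) =
    \sum_(c <- cuts t | P (b, c)) \sum_(s <- marks ts | all P s)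
       Phi ((b, c) :: s).
  rewrite big_map [RHS]big_mkcond; apply: eq_bigr => c _.
  by case: (P _) => /=; [rewrite -big_mkcond | rewrite big1].
by rewrite !E.
Qed.

(** Only the empty cut has no marks, and its trunk is the whole tree. An arbitrary summand [Phi]
    lets the induction absorb the nested sums over the branches. *)
Lemma big_nocut t (Phi : ptree -> seq ptree -> nat) :
  \sum_(c <- cuts t | nocut c) Phi (trunk c) (pruned c) = Phi t [::].
Proof.
elim/ptree_rect_nested: t Phi => ts IH Phi.
rewrite cutsE big_map.
rewrite (eq_bigl (all (fun bc => ~~ bc.1 && nocut bc.2))); last first.
  exact: nocutE.
elim: ts IH Phi => [|t ts IHts] /= => [_|[IHt IH]] Phi.
  by rewrite big_mkcond big_seq1.
(* The sum over cuts of the first edge is empty, since the predicate forbids a mark there. *)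
rewrite big_marks_cons /= [X in _ + X]big_pred0 // addn0.
rewrite -(IHts IH (fun u => Phi (PNode (t :: branches u)))).
rewrite -(IHt (fun u p => \sum_(s <- marks ts | all _ s)
  Phi (PNode (u :: branches (trunk (Cut s)))) (p ++ pruned (Cut s)))) /=.
by [].
Qed.

(** The cocycle identity of grafting $B_+$: $\Delta(B_+(U)) = B_+(U)\otimes 1 + (\mathrm{id}\otimes
    B_+)\Delta(U)$. Cutting the edge to a branch $t$ matches the term $t\otimes 1$ of $\Delta(t)$;
    keeping it matches a term $P^c(t)\otimes R^c(t)$. *)
Lemma big_foissy_tree_comul U (Phi : forest -> forest -> nat) :
  \sum_(p <- foissy_tree_comul (PNode U)) Phi p.1 p.2 =
    Phi (FMonom [:: PNode U]) mone
  + \sum_(p <- foissy_comul (FMonom U)) Phi p.1 (FMonom [:: PNode p.2]).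
Proof.
rewrite big_cons; congr (_ + _).
rewrite big_map big_filter cutsE big_map.
rewrite (eq_bigl (all admissible_mark)); last first.
  exact: admissibleE.
elim: U Phi => [|t U IH] Phi.
  by rewrite foissy_comul_nil big_mkcond !big_seq1.
rewrite foissy_comul_cons big_allpairs_dep big_cons big_map big_filter /=.
rewrite big_marks_cons addnC.
congr (_ + _).
  (* Below the cut edge only the empty cut is left. *)
  rewrite (big_nocut t (fun u p => \sum_(s <- marks U | all admissible_mark s)
     Phi (FMonom (u :: p ++ pruned (Cut s))) (FMonom [:: trunk (Cut s)]))).
  rewrite (IH (fun P R => Phi (FMonom (t :: P)) R)); apply: eq_bigr => p _.
  by rewrite -[mmul _ _]/(fmmul _ _) fmmulE fmM fm1.
apply: eq_bigr => c _.
(* Here [R] is always a forest of one tree, so the default of [head] is never reached. *)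
rewrite (IH (fun P R => Phi (FMonom (pruned c ++ P))
  (FMonom [:: PNode (trunk c :: branches (head (PNode [::]) R))]))).
apply: eq_bigr => p _.
by rewrite -[mmul _ _]/(fmmul _ _) fmmulE fmM.
Qed.

(* The brackets of trees being irreducible, no component letter straddles the
   end of [bba_of t]: the initial part of the shuffle that spells [bba_of t] is
   an admissible cut of [t], with pruned part p.1 and trunk p.2. *)
Lemma nshuffles_bba_of t F w r :
  nshuffles F w (bba_of t ++ r) =
  \sum_(p <- foissy_comul (FMonom (branches t)))
    strip2 p.1 (bba_of_forest p.2) F w (fun F' w' => nshuffles F' w' r).
Proof.
elim/ptree_rect_nested: t F w r => ts IH F w r; rewrite bba_ofE /=.
elim: ts IH F w r => [|t ts IHts] => [_|[IHt IH]] F w r.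
  by rewrite foissy_comul_nil big_seq1 strip2_nil.
rewrite -[bba_of_forest (t :: ts)]/(bracket t ++ bba_of_forest ts) -catA.
rewrite nshuffles_bracket.
rewrite foissy_comul_cons big_allpairs_dep /=.
case: t IHt => U /= IHU.
rewrite (big_foissy_tree_comul U (fun P R => \sum_(q <- foissy_comul (FMonom ts))
  strip2 (mmul P q.1) (bba_of_forest (mmul R q.2)) F w
    (fun F' w' => nshuffles F' w' r))).
congr (_ + _).
  rewrite (eq_strip2 _ _ _ _ (fun F' w' => IHts IH F' w' r)) strip2_sum.
  apply: eq_bigr => q _.
  by rewrite !fmM fm1 -strip2_cat.
(* The first tree stays in the trunk: its interior, its closing bracket and the remaining trees are
   read in turn, each removing its share of [F] and [w]. *)
rewrite (eq_strip2 _ _ _ _ (fun F' w' => IHU F' w' _)) strip2_sum.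
apply: eq_bigr => p _.
rewrite -strip2_cat (eq_strip2 _ _ _ _ (fun F' w' => nshuffles_rangle F' w' _)).
rewrite -strip2_cat.
rewrite (eq_strip2 _ _ _ _ (fun F' w' => IHts IH F' w' r)) strip2_sum.
apply: eq_bigr => q _.
rewrite -strip2_cat !fmM bba_of_forest_cat !cats0 cat0s.
by rewrite /bba_of_forest /= cats0 -cats1.
Qed.

(** With nothing left to spell, a term of the coproduct counts exactly when it uses up both [F] and
    the word of [G]. *)
Lemma nshuffles_foissy_comul (F G H : forest) :
  nshuffles F (bba_of_forest G) (bba_of_forest H) =
  count_mem (F, G) (foissy_comul H).
Proof.
have strip_all (T : eqType) (s t : seq T) :
    prefix s t && (drop (size s) t == [::]) = (t == s).
  apply/andP/eqP => [[/prefixP[v ->]]|->]; last by rewrite prefix_refl drop_size.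
  by rewrite drop_size_cat // => /eqP ->; rewrite cats0.
rewrite -[bba_of_forest H]cats0 -[bba_of_forest H]/(bba_of (PNode H)).
rewrite nshuffles_bba_of [FMonom _]fmK -sum1_count [RHS]big_mkcond.
apply: eq_bigr => -[P R] _; rewrite /strip2 nshuffles_nil /=.
rewrite xpair_eqE (fmP P F) (fmP R G) (eq_sym (val P)) (eq_sym (val R)).
rewrite -(inj_eq bba_of_forest_inj (val G)) -(strip_all _ (val P)).
rewrite -(strip_all _ (bba_of_forest R)).
by case: (prefix P F); case: (prefix _ _); rewrite ?andbF.
Qed.


(** A component leaves the depth unchanged wherever it is inserted. Hence the shuffles in the
    product are balanced, and [tree_of_bba] is applied only where it inverts [bba_of]. *)
Lemma flatten_shuffles_bba d F w x :
  bba_from d w -> x \in shuffles (map bracket F) (letters w) ->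
  bba_from d (flatten x).
Proof.
elim: F d w x => [|t F IHF] d w x.
  by rewrite nil_shuffles inE => dw /eqP ->; rewrite flatten_letters.
have bracket_from e v :
    bba_from e (flatten (bracket t :: v)) = bba_from e (flatten v).
  rewrite -[flatten (_ :: _)]/(bracket t ++ flatten v) bracket_cat.
  by rewrite /= bba_from_bba_of.
elim: w d x => [|b w IHw] d x dw.
  rewrite shuffles_nil inE => /eqP ->; rewrite bracket_from.
  by apply: IHF dw _; rewrite shuffles_nil inE.
rewrite shuffles_cons mem_cat => /orP[] /mapP[y yP ->].
  by rewrite bracket_from; apply: (IHF d (b :: w)).
by case: b d dw yP => [|] [|d] //= dw yP; apply: IHw yP.
Qed.

Lemma count_shuffles_tree (t t' u : ptree) :
  count_mem u [seq tree_of_bba (flatten w)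
                 | w <- shuffles (bba_components t) [seq [:: b] | b <- bba_of t']] =
  count_mem (FMonom (branches t), FMonom (branches t'))
    (foissy_comul (FMonom (branches u))).
Proof.
rewrite -nshuffles_foissy_comul /= -!bba_ofE /nshuffles count_map.
apply: eq_in_count => x xP /=.
have := flatten_shuffles_bba (d := 0) _ xP.
rewrite -(is_bbaE (bba_of t')) -is_bbaE.
move=> /(_ (bba_of_is_bba _)) /tree_of_bbaK E.
by rewrite -(inj_eq (can_inj bba_ofK)) E.
Qed.

Local Open Scope ring_scope.

(** * Linear extension from a basis *)

Section LinearExtension.
Variables (k : fieldType) (K : choiceType) (V : lmodType k).
Implicit Types (phi : K -> V) (x : {malg k[K]}).

Definition linext phi x : V := \sum_(t <- msupp x) x@_t *: phi t.

Lemma linextEw phi (d : {fset K}) x :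
  (msupp x `<=` d)%fset -> linext phi x = \sum_(t <- d) x@_t *: phi t.
Proof.
move=> xd; apply: big_fset_incl => // t _ /mcoeff_outdom ->.
by rewrite scale0r.
Qed.

Fact linext_linear phi : linear (linext phi).
Proof.
(* One finite set containing all three supports, as the support of the combination may shrink by
   cancellation. *)
move=> a x y; pose d := (msupp (a *: x + y)%R `|` (msupp x `|` msupp y))%fset.
rewrite !(@linextEw phi d) ?scaler_sumr -?big_split; last 3 first.
- by apply/fsubsetP => t; rewrite !in_fsetU => ->; rewrite !orbT.
- by apply/fsubsetP => t; rewrite !in_fsetU => ->; rewrite !orbT.
- by apply/fsubsetP => t; rewrite !in_fsetU => ->.
by apply: eq_bigr => t _ /=; rewrite mcoeffD mcoeffZ scalerDl scalerA.
Qed.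

HB.instance Definition _ phi :=
  GRing.isLinear.Build k {malg k[K]} V *:%R (linext phi) (linext_linear phi).

Lemma linextU phi c t : linext phi << c *g t >> = c *: phi t.
Proof.
rewrite (linextEw _ (d := [fset t]%fset)) ?msuppU_le // big_seq_fset1.
by rewrite mcoeffUU.
Qed.

Lemma linextU1 phi t : linext phi << t >> = phi t.
Proof. by rewrite linextU scale1r. Qed.

Lemma malgUZ (c : k) (t : K) : << c *g t >> = c *: << t >> :> {malg k[K]}.
Proof. by apply/malgP => u; rewrite mcoeffZ !mcoeffU mulr_natr. Qed.

Lemma linextE (f : {linear {malg k[K]} -> V}) x :
  f x = linext (fun t => f << t >>) x.
Proof.
rewrite {1}(monalgE x) raddf_sum; apply: eq_bigr => t _.
by rewrite malgUZ; exact: linearZ_LR.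
Qed.

Lemma eq_linext phi psi : phi =1 psi -> linext phi =1 linext psi.
Proof. by move=> E x; apply: eq_bigr => t _; rewrite E. Qed.

End LinearExtension.

Lemma linext_mcoeff (k : fieldType) (K : choiceType) (x : {malg k[K]}) u :
  x@_u = linext (fun t => (t == u)%:R : k^o) x.
Proof.
rewrite {1}(monalgE x) raddf_sum; apply: eq_bigr => t _.
by rewrite /= mcoeffU; apply/esym/mulr_natr.
Qed.

Lemma malgM_linext (k : fieldType) (K : monomType) (x y : {malg k[K]}) :
  x * y = linext (fun t => linext (fun u => << mmul t u >>) y) x.
Proof.
rewrite malgME; apply: eq_bigr => t _; rewrite scaler_sumr.
by apply: eq_bigr => u _; rewrite malgUZ scalerA.
Qed.

(** * Equality of tensors tested on coefficients *)

Section TensorEq.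
Variables (k : fieldType) (K : choiceType).

(** Expanding both factors in the basis shows that a bilinear map sees a formal sum only through its
    coefficients. *)
Lemma tensor_eq_coef (s s' : seq ({malg k[K]} * {malg k[K]})) :
  (forall t u, \sum_(p <- s) p.1@_t * p.2@_u = \sum_(p <- s') p.1@_t * p.2@_u) ->
  tensor_eq s s'.
Proof.
move=> ss' W B.
have [d dP] : exists d : {fset K}, forall p, p \in s ++ s' ->
    (msupp p.1 `<=` d)%fset && (msupp p.2 `<=` d)%fset.
  elim: (s ++ s') => [|p r [d IH]]; first by exists fset0.
  exists (d `|` (msupp p.1 `|` msupp p.2))%fset => q.
  rewrite inE => /predU1P[->|/IH/andP[q1 q2]].
    by rewrite [(d `|` _)%fset]fsetUC -fsetUA fsubsetUl fsetUCA fsubsetUl.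
  by rewrite !(fsubset_trans _ (fsubsetUl _ _)).
have expand r : {subset r <= s ++ s'} -> \sum_(p <- r) B p.1 p.2 =
    \sum_(t <- d) \sum_(u <- d)
      (\sum_(p <- r) p.1@_t * p.2@_u) *: B << t >> << u >>.
  move=> rs; under [RHS]eq_bigr => t _.
    under eq_bigr do rewrite scaler_suml.
    rewrite exchange_big; over.
  rewrite exchange_big; apply: eq_big_seq => -[x y] /rs/dP /andP[/= xd yd].
  rewrite -(applyrE B) (linextE (applyr B y)) (linextEw _ xd).
  apply: eq_bigr => t _ /=; rewrite (linextE (B << t >>)) (linextEw _ yd).
  by rewrite scaler_sumr; apply: eq_bigr => u _; rewrite scalerA.
rewrite !expand; first by under eq_bigr do under eq_bigr do rewrite ss'.
  by move=> p ps; rewrite mem_cat ps orbT.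
by move=> p ps; rewrite mem_cat ps.
Qed.

End TensorEq.

(** * The pairing of trees with forests *)

Section Duality.
Variable k : fieldType.

Local Notation TH := (tree_hopf k).
Local Notation FH := (foissy_hopf k).
Local Notation DH := (graded_dual FH).

Lemma eq_branches (F : forest) t : (FMonom (branches t) == F) = (t == PNode F).
Proof. by case: t => ts; apply/eqP/eqP => [<-|[->]] //; rewrite fmK. Qed.

Lemma tree_mul_coef t t' u :
  (tree_mul k t t')@_u =
  (count_mem (FMonom (branches t), FMonom (branches t'))
    (foissy_comul (FMonom (branches u))))%:R.
Proof.
rewrite -count_shuffles_tree count_map -sum1_count natr_sum raddf_sum /=.
rewrite [RHS]big_mkcond; apply: eq_bigr => w _.
by rewrite mcoeffU /=; case: eqP.
Qed.

Lemma tree_hmulE (x y : TH) :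
  hmul x y = linext (fun t => linext (tree_mul k t) y) x.
Proof.
apply: eq_bigr => t _; rewrite scaler_sumr.
by apply: eq_bigr => u _; rewrite scalerA.
Qed.

(** The bilinear extension of the multiplicity identity: the product of trees is transpose to the
    coproduct of forests. *)
Lemma tree_hmul_coef (x y : TH) (F : forest) :
  (hmul x y : {malg k[ptree]})@_(PNode F) =
  \sum_(p <- foissy_comul F) x@_(PNode p.1) * y@_(PNode p.2).
Proof.
have -> : (hmul x y : {malg k[ptree]})@_(PNode F) =
    \sum_(t <- msupp x) \sum_(u <- msupp y) \sum_(p <- foissy_comul F)
      (x@_t * (t == PNode p.1)%:R) * (y@_u * (u == PNode p.2)%:R).
  rewrite raddf_sum; apply: eq_bigr => t _.
  rewrite raddf_sum; apply: eq_bigr => u _.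
  rewrite /= mcoeffZ tree_mul_coef fmK -sum1_count natr_sum mulr_sumr.
  rewrite big_mkcond; apply: eq_bigr => -[P R] _ /=.
  rewrite xpair_eqE (eq_sym P) (eq_sym R) !eq_branches.
  rewrite mulrACA -natrM mulnb.
  by case: ifP => // _; rewrite mulr0.
under eq_bigr do rewrite exchange_big.
rewrite exchange_big; apply: eq_bigr => p _.
rewrite (linext_mcoeff x) (linext_mcoeff y) mulr_suml; apply: eq_bigr => t _.
by rewrite mulr_sumr.
Qed.

(** Only the splitting at position [size ts] can produce this pair. *)
Lemma count_tree_comul t (ts us : seq ptree) :
  count_mem (PNode ts, PNode us) (tree_comul t) = (t == PNode (ts ++ us)).
Proof.
case: t => vs; rewrite count_map.
have E i : i \in iota 0 (size vs).+1 ->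
    ((PNode (take i vs), PNode (drop i vs)) == (PNode ts, PNode us)) =
    (vs == ts ++ us) && (i == size ts).
  rewrite mem_iota add0n ltnS => /= iv.
  apply/eqP/andP => [[<- <-]|[/eqP-> /eqP->]].
    by rewrite cat_take_drop eqxx size_takel.
  by rewrite take_size_cat // drop_size_cat.
rewrite (eq_in_count E) (_ : PNode vs == _ = (vs == ts ++ us)); last first.
  by apply/eqP/eqP => [[]|->].
case: eqP => [->|_]; last by rewrite -[LHS]/(count pred0 _) count_pred0.
rewrite -[LHS]/(count_mem (size ts) (iota 0 (size (ts ++ us)).+1)).
by rewrite count_uniq_mem ?iota_uniq // mem_iota size_cat add0n ltnS leq_addr.
Qed.

Lemma tree_hcomul_coef (x : TH) (ts us : seq ptree) :
  \sum_(p <- hcomul x) (p.1 : {malg k[ptree]})@_(PNode ts) *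
     (p.2 : {malg k[ptree]})@_(PNode us) = x@_(PNode (ts ++ us)).
Proof.
rewrite big_allpairs_dep (linext_mcoeff x); apply: eq_bigr => t _ /=.
rewrite -count_tree_comul -sum1_count natr_sum scaler_sumr [RHS]big_mkcond.
apply: eq_bigr => -[u v] _ /=; rewrite !mcoeffU xpair_eqE.
by do 2!case: eqP => _; rewrite ?mulr0 ?mul0r // /GRing.scale.
Qed.

(** The pairing for which the trees [PNode F] and the forests [F] are dual bases. *)
Definition tree_pairing (x : {malg k[ptree]}) (y : {malg k[forest]}) : k^o :=
  linext (fun F : forest => x@_(PNode F) : k^o) y.

HB.instance Definition _ x := GRing.Linear.copy (tree_pairing x) (linext _).

Lemma tree_pairingU x c (F : forest) :
  tree_pairing x << c *g F >> = c * x@_(PNode F).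
Proof. exact: linextU. Qed.

Lemma tree_pairingU1 x (F : forest) : tree_pairing x << F >> = x@_(PNode F).
Proof. by rewrite tree_pairingU mul1r. Qed.

Lemma tree_pairing_gdual x : tree_pairing x \in @gdual_pred k FH.
Proof.
apply/asboolP; split; first exact: linext_linear.
(* A bound strictly above the degree of every tree in the support. *)
exists (\sum_(t <- msupp x) (nonroot_vertices t).+1)%N => n y Nn yn.
rewrite /tree_pairing /linext big_seq big1 // => F /yn En.
rewrite (@mcoeff_outdom _ _ x) ?scaler0 //; apply/negP => Fx.
(* The degree of [F] is by definition the number of non-root vertices of [PNode F]. *)
move: Nn; rewrite (big_rem _ Fx) (En : nonroot_vertices (PNode F) = n).
by move=> /(leq_trans (leq_addr _ _)); rewrite ltnn.
Qed.

Definition to_dual (x : TH) : DH := gdual_of (H := FH) (tree_pairing x).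

Lemma val_to_dual x : \val (to_dual x) = tree_pairing x.
Proof. exact: insubdK (tree_pairing_gdual x). Qed.

Lemma gdual_val_linear (a : k) (u v : DH) :
  \val (a *: u + v : DH) = a *: \val u + \val v.
Proof. exact: (linearP (\val : gdual FH -> _)). Qed.

Fact to_dual_linear : linear to_dual.
Proof.
move=> a x y; apply: val_inj.
rewrite gdual_val_linear !val_to_dual; apply/funext => z.
rewrite fctE /= fctE [LHS]/tree_pairing /linext scaler_sumr -big_split.
apply: eq_bigr => F _.
by rewrite mcoeffD mcoeffZ scalerDr !scalerA mulrC -!scalerA.
Qed.

HB.instance Definition _ :=
  GRing.isLinear.Build k TH DH *:%R to_dual to_dual_linear.

Lemma to_dual_coef x t : \val (to_dual x) << FMonom (branches t) >> = x@_t.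
Proof. by rewrite val_to_dual tree_pairingU1; case: t. Qed.

Lemma to_dual_inj : injective to_dual.
Proof.
by move=> x y E; apply/malgP => t; rewrite -!to_dual_coef E.
Qed.

(** Local finiteness: a tree with $m$ non-root vertices is coded by a word of $2m$ brackets. *)
Lemma finitely_many_trees n :
  exists d : {fset ptree}, forall t, (nonroot_vertices t < n)%N -> t \in d.
Proof.
pose words m := [seq tree_of_bba (val w) | w <- enum {: m.*2.-tuple bool}].
exists [fset t in flatten [seq words m | m <- iota 0 n]]%fset => t tn.
rewrite inE; apply/flatten_mapP; exists (nonroot_vertices t).
  by rewrite mem_iota.
have size_t : size (bba_of t) == (nonroot_vertices t).*2.
  rewrite -(count_predC (pred1 langle)) -addnn count_langle_bba_of eqn_add2l.
  have /andP[_ /eqP E] := bba_of_is_bba t.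
  by rewrite -count_langle_bba_of E; apply/eqP/eq_count; case.
apply/mapP; exists (Tuple size_t); rewrite ?mem_enum //.
by rewrite bba_ofK.
Qed.

(** A form in the graded dual vanishes on forests of large degree, so its values on the finitely
    many others are the coefficients of a preimage. *)
Lemma to_dual_surj (f : DH) : exists x, to_dual x = f.
Proof.
have /asboolP[lf [N fN]] := valP f.
have [d dP] := finitely_many_trees N.
pose h : {linear FH -> k^o} :=
  HB.pack (\val f) (GRing.isLinear.Build _ _ _ _ _ lf).
exists [malg t in d => \val f << FMonom (branches t) >>].
apply: val_inj; apply/funext => y; rewrite val_to_dual.
rewrite -[RHS]/(h y) [RHS]linextE; apply: eq_linext => F.
rewrite mcoeffE [FMonom _]fmK; case: ifP => // /negP Fd.
apply/esym/(fN (nonroot_vertices (PNode F))).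
  by rewrite leqNgt; apply/negP => /dP.
by move=> G; rewrite msuppU1 inE => /eqP ->.
Qed.

Lemma to_dual_deg n (x : TH) : hdeg n x <-> hdeg n (to_dual x).
Proof.
split=> [xn m y mn ym|xn t tx].
  rewrite val_to_dual /tree_pairing /linext big_seq big1 // => F /ym Fm.
  rewrite (@mcoeff_outdom _ _ x) ?scaler0 //; apply/negP => /xn.
  by move=> Fn; apply: mn; rewrite -Fm -Fn.
apply/eqP; apply: contraLR tx => /eqP tn.
rewrite -mcoeff_eq0 -to_dual_coef; apply/eqP/(xn (nonroot_vertices t)) => //.
by move=> G; rewrite msuppU1 inE => /eqP ->; case: t {tn}.
Qed.

Lemma to_dual_one : to_dual hone = hone.
Proof.
(* Both sides are packed by [gdual_of], so it suffices to compare the underlying functions. *)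
apply: (congr1 (@gdual_of k FH)); apply/funext => y.
rewrite [RHS]linext_mcoeff; apply: eq_linext => F.
by rewrite mcoeffU -eq_branches eq_sym -[mone]/(fmone _) fmoneE.
Qed.

Lemma to_dual_mul (x y : TH) :
  to_dual (hmul x y) = hmul (to_dual x) (to_dual y).
Proof.
apply: (congr1 (@gdual_of k FH)); apply/funext => z.
rewrite !val_to_dual big_allpairs_dep.
apply: eq_bigr => F _; rewrite tree_hmul_coef scaler_sumr.
apply: eq_bigr => p _ /=.
by rewrite tree_pairingU1 tree_pairingU; apply: mulrA.
Qed.

Lemma to_dual_counit (x : TH) : hcounit (to_dual x) = hcounit x.
Proof.
by rewrite /= val_to_dual tree_pairingU1 fm1.
Qed.

(** Deconcatenation is transpose to concatenation; the image of the tree coproduct thus has the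
    property by which [gdual_comul] is selected. *)
Lemma to_dual_comul (x : TH) (y z : FH) :
  \sum_(p <- hcomul x) \val (to_dual p.1) y * \val (to_dual p.2) z =
  \val (to_dual x) (hmul y z).
Proof.
have -> : \val (to_dual x) (hmul y z) = \sum_(F <- msupp y) \sum_(G <- msupp z)
    y@_F * z@_G * x@_(PNode (mmul F G)).
  rewrite val_to_dual [hmul y z]malgME raddf_sum; apply: eq_bigr => F _.
  by rewrite raddf_sum; apply: eq_bigr => G _; apply: tree_pairingU.
under [RHS]eq_bigr => F _ do under eq_bigr => G _ do
  rewrite fmM -tree_hcomul_coef mulr_sumr.
under [RHS]eq_bigr do rewrite exchange_big.
rewrite [RHS]exchange_big; apply: eq_bigr => p _.
rewrite !val_to_dual mulr_suml; apply: eq_bigr => F _; rewrite mulr_sumr.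
by apply: eq_bigr => G _; rewrite mulrACA.
Qed.

End Duality.

(** * Antipodes and the isomorphism *)

Section TreeAntipode.
Variable k : fieldType.

Local Notation TH := (tree_hopf k).

Lemma tree_hmul_linearl (y : TH) : linear (fun x : TH => hmul x y).
Proof. by move=> a u v; rewrite !tree_hmulE linearP. Qed.

Lemma tree_hmul_linearr (x : TH) : linear (hmul x).
Proof.
move=> a u v; rewrite !tree_hmulE scaler_sumr -big_split.
apply: eq_bigr => t _ /=.
by rewrite linearP scalerDr !scalerA mulrC.
Qed.

(** The one-vertex tree has the empty word, into which there is exactly one shuffle. *)
Lemma tree_hmulr1 (x : TH) : hmul x (<< PNode [::] >> : TH) = x.
Proof.
rewrite tree_hmulE [RHS](linextE idfun); apply: eq_linext => t.
rewrite linextU1 /tree_mul /= shuffles_nil big_seq1.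
by rewrite -[flatten _]bba_ofE bba_ofK.
Qed.

Lemma big_tree_hcomulU (W : nmodType) (t : ptree) (Phi : TH -> TH -> W) :
  \sum_(p <- hcomul (<< t >> : TH)) Phi p.1 p.2 =
  \sum_(p <- tree_comul t) Phi << p.1 >> << p.2 >>.
Proof.
rewrite big_allpairs_dep msuppU oner_eq0 big_seq_fset1 /=.
by rewrite mcoeffUU.
Qed.

(* The last term of the sum is S t itself, since the empty tree is a right unit;
   the others are values of S at trees whose root has fewer branches. *)
Lemma tree_left_antipode_unique (S S' : {linear TH -> TH}) :
  (forall x, \sum_(p <- hcomul x) hmul (S p.1) p.2 = hcounit x *: hone) ->
  (forall x, \sum_(p <- hcomul x) hmul (S' p.1) p.2 = hcounit x *: hone) ->
  S =1 S'.
Proof.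
move=> SP S'P.
suff E t : S << t >> = S' << t >>.
  by move=> x; rewrite (linextE S) (linextE S'); apply: eq_linext.
have [n] := ubnP (size (branches t)); elim: n t => // n IH [ts] /= tn.
have := etrans (SP << PNode ts >>) (esym (S'P << PNode ts >>)).
rewrite (big_tree_hcomulU _ (fun u v => hmul (S u) v)).
rewrite (big_tree_hcomulU _ (fun u v => hmul (S' u) v)).
rewrite !big_map -(subn0 (size ts).+1) -/(index_iota 0 (size ts).+1).
rewrite !big_nat_recr // !drop_size !take_size.
rewrite !tree_hmulr1.
rewrite (eq_big_nat _ _ (F2 := fun i => hmul (S' << PNode (take i ts) >>)
  << PNode (drop i ts) >>)) => [/addrI //|i /andP[_ i_lt]].
by rewrite IH //= size_take i_lt (leq_trans i_lt).
Qed.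

End TreeAntipode.

(** * The isomorphism from the graded dual to trees *)

Section Isomorphism.
Variable k : fieldType.

Local Notation TH := (tree_hopf k).
Local Notation DH := (graded_dual (foissy_hopf k)).

Definition of_dual (f : DH) : TH := sval (cid (to_dual_surj f)).

Lemma of_dualK : cancel of_dual (@to_dual k).
Proof. by move=> f; rewrite /of_dual; case: cid. Qed.

Lemma to_dualK : cancel (@to_dual k) of_dual.
Proof. by move=> x; apply: to_dual_inj; rewrite of_dualK. Qed.

HB.instance Definition _ := GRing.isLinear.Build k DH TH *:%R of_dual
  (can2_linear to_dualK of_dualK).

Lemma of_dual_coef (f : DH) t :
  (of_dual f)@_t = \val f << FMonom (branches t) >>.
Proof. by rewrite -to_dual_coef of_dualK. Qed.

(** The choice made by [xget] has the required property as soon as some list does, and the image of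
    the tree coproduct is such a list. *)
Lemma dual_hcomul (f : DH) (y z : foissy_hopf k) :
  \sum_(p <- hcomul f) \val p.1 y * \val p.2 z = \val f (hmul y z).
Proof.
pose P := [set s : seq (gdual (foissy_hopf k) * gdual (foissy_hopf k)) |
  forall y z : foissy_hopf k,
    \sum_(p <- s) \val p.1 y * \val p.2 z = \val f (hmul y z)]%classic.
suff: P (hcomul f) by apply.
apply: xgetPex.
exists [seq (to_dual p.1, to_dual p.2) | p <- hcomul (of_dual f)] => u v /=.
by rewrite big_map to_dual_comul of_dualK.
Qed.

(** Tree coefficients are values on forests, so on both sides the coefficient at a pair of trees is
    the value of [f] at the concatenated forest. *)
Lemma of_dual_comul (f : DH) :
  tensor_eq (hcomul (of_dual f))
    [seq (of_dual p.1, of_dual p.2) | p <- hcomul f].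
Proof.
apply: tensor_eq_coef => -[ts] [us]; rewrite big_map tree_hcomul_coef.
under [RHS]eq_bigr do rewrite !of_dual_coef.
rewrite dual_hcomul of_dual_coef /= malgM_linext !linextU1.
by rewrite -[mmul _ _]/(fmmul _ _) fmmulE.
Qed.

(** The antipode [S], transported to trees, is a left convolution inverse of the identity, and such
    an inverse is unique. *)
Lemma of_dual_antipode (S : {linear DH -> DH}) (S' : {linear TH -> TH}) :
  is_antipode S -> is_antipode S' -> forall f, of_dual (S f) = S' (of_dual f).
Proof.
move=> SP S'P f.
pose T : {linear TH -> TH} := (of_dual \o S \o @to_dual k).
have Blin : bilinear_for *:%R *:%R (fun u v : TH => hmul (T u) v).
  split=> [v a u u'|u]; last exact: tree_hmul_linearr.
  by rewrite linearP; apply: tree_hmul_linearl.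
(* The coproducts agree only up to [tensor_eq], so the convolution must be presented as a bilinear
   map. *)
pose B : {bilinear TH -> TH -> TH} :=
  HB.pack (fun u v : TH => hmul (T u) v)
    (bilinear_isBilinear.Build _ _ _ _ _ _ _ Blin).
have TP x : \sum_(p <- hcomul x) hmul (T p.1) p.2 = hcounit x *: hone.
  transitivity (\sum_(p <- hcomul (to_dual x)) B (of_dual p.1) (of_dual p.2)).
    by have := of_dual_comul (to_dual x) B; rewrite to_dualK big_map.
  have [SPx _] := SP (to_dual x).
  rewrite -to_dual_counit -[hone](to_dualK) to_dual_one -linearZ -SPx.
  rewrite linear_sum; apply: eq_bigr => p _ /=.
  by apply: to_dual_inj; rewrite to_dual_mul !of_dualK.
have S'l x : \sum_(p <- hcomul x) hmul (S' p.1) p.2 = hcounit x *: hone.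
  by have [] := S'P x.
by rewrite -(tree_left_antipode_unique TP S'l) /= of_dualK.
Qed.


Lemma of_dual_graded_hopf_iso : is_graded_hopf_iso of_dual.
Proof.
split.
- by exists (@to_dual k); [apply: of_dualK | apply: to_dualK].
- by move=> n f; rewrite to_dual_deg of_dualK.
- by move=> f g; apply: to_dual_inj; rewrite to_dual_mul !of_dualK.
- by apply: to_dual_inj; rewrite to_dual_one of_dualK.
- exact: of_dual_comul.
- by move=> f; rewrite -to_dual_counit of_dualK.
- exact: of_dual_antipode.
Qed.

End Isomorphism.

Theorem theorem5p2 (k : fieldType) (k_char0 : [pchar k] =i pred0) :
  graded_hopf_isomorphic (graded_dual (foissy_hopf k)) (tree_hopf k).
Proof. by exists (@of_dual k); apply: of_dual_graded_hopf_iso. Qed.
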